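(* Let $A,B$ be commutative rings with unity, $f:A\to B$ a ring homomorphism, and $J$ an ideal of $B$. Assume that $J$, as an $A$-module (via $f$), is generated by $\{j_\lambda\mid\lambda\in\Lambda\}$. Then $A\bowtie^f J$ is a homomorphic image of $A[X_\lambda\mid\lambda\in\Lambda]$, the ring of polynomials over $A$ in indeterminates $X_\lambda$, $\lambda\in\Lambda$.
   Context: For a ring homomorphism $f:A\to B$ of commutative rings and an ideal $J$ of $B$, the amalgamation is the subring $A\bowtie^f J:=\{(a,f(a)+j)\mid a\in A,\ j\in J\}$ of $A\times B$. *)

(* Defs.v *)
From HB Require Import structures.
From mathcomp Require Import all_boot all_algebra finmap.
From mathcomp.multinomials Require Import monalg.
From mathcomp Require Import boolp classical_sets.

Set Implicit Arguments.
Unset Strict Implicit.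
Unset Printing Implicit Defensive.

Import GRing.Theory.

Local Open Scope classical_set_scope.
Local Open Scope ring_scope.

(* The ring structure of [{malg A[K]}] is only declared for nontrivial rings A,
   and [idealr] only covers proper ideals of nontrivial rings; here A and B may
   be the zero ring and J may be the unit ideal. *)

(* A[X_l | l in L]: finitely supported families of coefficients in A indexed by
   the commutative monomials in the indeterminates X_l. *)
Definition polyring (A : comPzRingType) (L : choiceType) : Type :=
  {malg A[{cmonom L}]}.

Section PolyRing.
Variables (A : comPzRingType) (L : choiceType).
Implicit Types (p q r : {malg A[{cmonom L}]}) (c : A) (k : {cmonom L}).

Definition polyring_one : {malg A[{cmonom L}]} := mkmalgU (@mone {cmonom L}) 1.

Definition polyring_mul p q : {malg A[{cmonom L}]} :=
  \sum_(k1 <- msupp p) \sum_(k2 <- msupp q)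
    mkmalgU (mmul k1 k2) (mcoeff k1 p * mcoeff k2 q).

Lemma polyring_mulw (d1 d2 : {fset {cmonom L}}) p q :
  (msupp p `<=` d1)%fset -> (msupp q `<=` d2)%fset ->
  polyring_mul p q = \sum_(k1 <- d1) \sum_(k2 <- d2)
    mkmalgU (mmul k1 k2) (mcoeff k1 p * mcoeff k2 q).
Proof.
move=> le_d1 le_d2; rewrite /polyring_mul (big_fset_incl _ le_d1) /=.
  apply/eq_bigr=> k1 _; apply/big_fset_incl => // k _ /mcoeff_outdom ->.
  by rewrite mulr0 monalgU0.
move=> k _ /mcoeff_outdom pk.
by rewrite big1 => // k' _; rewrite pk mul0r monalgU0.
Qed.

Lemma polyring_mulC : commutative polyring_mul.
Proof.
move=> p q; rewrite /polyring_mul exchange_big /=.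
apply/eq_bigr => k1 _; apply/eq_bigr => k2 _.
by rewrite mulmC mulrC.
Qed.

Lemma polyring_mul0 : left_zero 0 polyring_mul.
Proof. by move=> p; rewrite /polyring_mul msupp0 big_seq_fset0. Qed.

Lemma polyring_mulDl : left_distributive polyring_mul +%R.
Proof.
move=> p q r.
rewrite (polyring_mulw (msuppD_le p q) (fsubset_refl _)).
rewrite (polyring_mulw (fsubsetUl (msupp p) (msupp q)) (fsubset_refl (msupp r))).
rewrite (polyring_mulw (fsubsetUr (msupp p) (msupp q)) (fsubset_refl (msupp r))).
rewrite -big_split /=; apply/eq_bigr=> k1 _.
rewrite -big_split /=; apply/eq_bigr=> k2 _.
by rewrite mcoeffD mulrDl monalgUD.
Qed.

Lemma polyring_mulUU c1 c2 k1 k2 :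
  polyring_mul (mkmalgU k1 c1) (mkmalgU k2 c2) = mkmalgU (mmul k1 k2) (c1 * c2).
Proof. by rewrite (polyring_mulw msuppU_le msuppU_le) !big_seq_fset1 !mcoeffUU. Qed.

Lemma polyring_mul1 : left_id polyring_one polyring_mul.
Proof.
move=> p; rewrite (polyring_mulw msuppU_le (fsubset_refl _)) big_seq_fset1.
rewrite [RHS]monalgE; apply/eq_bigr => k _.
by rewrite mcoeffUU mul1r mul1m.
Qed.

Lemma polyring_mulA : associative polyring_mul.
Proof.
have suml I (s : seq I) F r : polyring_mul (\sum_(i <- s) F i) r =
    \sum_(i <- s) polyring_mul (F i) r.
  exact: (big_morph (polyring_mul^~ r) (fun _ _ => polyring_mulDl _ _ _)
    (polyring_mul0 r)).
have sumr I (s : seq I) F r : polyring_mul r (\sum_(i <- s) F i) =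
    \sum_(i <- s) polyring_mul r (F i).
  by rewrite polyring_mulC suml; apply/eq_bigr => i _; rewrite polyring_mulC.
have mulUA a b c k1 k2 k3 :
    polyring_mul (mkmalgU k1 a) (polyring_mul (mkmalgU k2 b) (mkmalgU k3 c)) =
    polyring_mul (polyring_mul (mkmalgU k1 a) (mkmalgU k2 b)) (mkmalgU k3 c).
  have := polyring_mulUU; move: polyring_mul mkmalgU => mu U muUU.
  by rewrite !muUU mulmA mulrA.
move: polyring_mul suml sumr mulUA => mu suml sumr mulUA p q r.
rewrite (monalgE p) [LHS]suml [X in _ = mu X _]suml [RHS]suml.
apply/eq_bigr => k1 _; set u := mkmalgU _ _.
rewrite (monalgE q) [X in mu _ X]suml [LHS]sumr [X in _ = mu X _]sumr [RHS]suml.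
apply/eq_bigr => k2 _; set v := mkmalgU _ _.
rewrite (monalgE r) [X in mu u X]sumr [LHS]sumr [RHS]sumr.
by apply/eq_bigr => k3 _; exact: mulUA.
Qed.

HB.instance Definition _ := GRing.Zmodule.copy (polyring A L) {malg A[{cmonom L}]}.
HB.instance Definition _ := GRing.Zmodule_isComPzRing.Build (polyring A L)
  polyring_mulA polyring_mulC polyring_mul1 polyring_mulDl.

End PolyRing.

Lemma polyring_malgM (A : comNzRingType) (L : choiceType)
    (p q : {malg A[{cmonom L}]}) :
  @GRing.mul (polyring A L) p q = @GRing.mul {malg A[{cmonom L}]} p q.
Proof. by []. Qed.

Lemma polyring_malg1 (A : comNzRingType) (L : choiceType) :
  @GRing.one (polyring A L) = @GRing.one {malg A[{cmonom L}]}.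
Proof. by []. Qed.

Definition is_ideal (B : comPzRingType) (J : set B) : Prop :=
  [/\ J 0, (forall x y, J x -> J y -> J (x + y))
    & forall b x, J x -> J (b * x)].

Record ideal (B : comPzRingType) := Ideal {
  ideal_set :> set B;
  idealP : is_ideal ideal_set
}.

(* The A-submodule of B, with action a . b = f a * b, generated by the family
   j: the set of all finite A-linear combinations of the j l. *)
Definition submod_gen (A B : comPzRingType) (f : {rmorphism A -> B})
    (L : Type) (j : L -> B) : set B :=
  [set x | exists s : seq (A * L), x = \sum_(t <- s) f t.1 * j t.2].

Section Amalgamation.
Variables (A B : comPzRingType) (f : {rmorphism A -> B}) (J : ideal B).

Definition amalg_set : set (A * B) :=
  [set x | exists a j, ideal_set J j /\ x = (a, f a + j)].

Fact amalg_subring_closed : subring_closed (fun x => x \in amalg_set).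
Proof.
have [J0 JD JM] := idealP J.
have JN x : ideal_set J x -> ideal_set J (- x) by rewrite -mulN1r; apply: JM.
split=> [|x y|x y].
- by apply/mem_set; exists 1, 0; rewrite rmorph1 addr0.
- move=> /set_mem[a [j [Jj ->]]] /set_mem[a' [j' [Jj' ->]]].
  apply/mem_set; exists (a - a'), (j - j'); split; first exact/JD/JN.
  rewrite -[LHS]/(a - a', (f a + j) - (f a' + j')).
  by rewrite rmorphB opprD addrACA.
- move=> /set_mem[a [j [Jj ->]]] /set_mem[a' [j' [Jj' ->]]].
  apply/mem_set; exists (a * a'), (f a * j' + (f a' + j') * j); split.
    by apply: JD; apply: JM.
  rewrite -[LHS]/(a * a', (f a + j) * (f a' + j')).
  by rewrite rmorphM mulrDl mulrDr [j * _]mulrC addrA.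
Qed.

Record amalg : Type := Amalg {
  amalg_val :> A * B;
  amalgP : amalg_val \in amalg_set
}.

HB.instance Definition _ := [isSub for amalg_val].
HB.instance Definition _ := [Choice of amalg by <:].
HB.instance Definition _ := GRing.SubChoice_isSubComPzRing.Build (A * B)%type
  (fun x => x \in amalg_set) amalg amalg_subring_closed.

End Amalgamation.

(* Main.v *)
(* The universal property of A[X_l | l in L] extends the ring homomorphism
   a |-> (a, f a) to the amalgamation by X_l |-> (0, j_l).  An element
   (a, f a + \sum_t f a_t j_(l_t)) is then the image of the polynomial
   a + \sum_t a_t X_(l_t) of degree at most one. *)

Require Import Defs.
From HB Require Import structures.
From mathcomp Require Import all_boot all_algebra finmap.
From mathcomp.multinomials Require Import monalg.
From mathcomp Require Import boolp classical_sets.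

Set Implicit Arguments.
Unset Strict Implicit.
Unset Printing Implicit Defensive.

Import GRing.Theory.

Local Open Scope ring_scope.

(* [monalg.mmap] is only available for nontrivial rings. *)
Section PolyringEval.
Variables (A S : comPzRingType) (L : choiceType).
Variables (h : {rmorphism A -> S}) (v : L -> S).
Implicit Types (m : {cmonom L}) (p q : polyring A L).

Definition cmonom_eval m : S := \prod_(i <- finsupp m) v i ^+ m i.

(** Exponents default to 0 off the support, so the extra factors are 1. Monomials with different
    supports can then be compared over a common index set. *)
Lemma cmonom_evalw (d : {fset L}) m : (finsupp m `<=` d)%fset ->
  cmonom_eval m = \prod_(i <- d) v i ^+ m i.
Proof.
move=> le_d; rewrite [LHS](big_fset_incl _ le_d) //= => i _ i_notin.
by rewrite fsfun_dflt // expr0.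
Qed.

Lemma cmonom_eval1 : cmonom_eval mone = 1.
Proof. by rewrite /cmonom_eval mdom1 big_seq_fset0. Qed.

Lemma cmonom_evalU i : cmonom_eval (ucm i) = v i.
Proof. by rewrite /cmonom_eval mdomU big_seq_fset1 cmUU expr1. Qed.

(** Over the union of the two supports, all three products share one index set and the exponents add
    pointwise. *)
Lemma cmonom_evalM m1 m2 :
  cmonom_eval (mmul m1 m2) = cmonom_eval m1 * cmonom_eval m2.
Proof.
rewrite (cmonom_evalw (d := finsupp m1 `|` finsupp m2)%fset) ?mdomD //.
rewrite (cmonom_evalw (fsubsetUl (finsupp m1) (finsupp m2))).
rewrite (cmonom_evalw (fsubsetUr (finsupp m1) (finsupp m2))).
by rewrite -big_split /=; apply: eq_bigr => i _; rewrite cmM exprD.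
Qed.

Definition polyring_mon m (c : A) : polyring A L := mkmalgU m c.

Definition polyring_eval p : S :=
  \sum_(m <- msupp p) h (mcoeff m p) * cmonom_eval m.

Lemma polyring_evalw (d : {fset {cmonom L}}) p : (msupp p `<=` d)%fset ->
  polyring_eval p = \sum_(m <- d) h (mcoeff m p) * cmonom_eval m.
Proof.
move=> le_d; rewrite [LHS](big_fset_incl _ le_d) //= => m _ /mcoeff_outdom ->.
by rewrite rmorph0 mul0r.
Qed.

Lemma polyring_evalU c m :
  polyring_eval (polyring_mon m c) = h c * cmonom_eval m.
Proof. by rewrite (polyring_evalw msuppU_le) big_seq_fset1 mcoeffUU. Qed.

Lemma polyring_eval_nmod_morphism : nmod_morphism polyring_eval.
Proof.
split=> [|p q]; first by rewrite /polyring_eval msupp0 big_seq_fset0.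
rewrite (polyring_evalw (msuppD_le p q)).
rewrite (polyring_evalw (fsubsetUl (msupp p) (msupp q))).
rewrite (polyring_evalw (fsubsetUr (msupp p) (msupp q))).
rewrite -big_split /=; apply: eq_bigr => m _.
by rewrite mcoeffD rmorphD mulrDl.
Qed.

HB.instance Definition _ :=
  GRing.isNmodMorphism.Build (polyring A L) S polyring_eval
    polyring_eval_nmod_morphism.

(** Additivity reduces multiplicativity to single terms, where it follows from [cmonom_evalM] and
    the commutativity of [S]. *)
Lemma polyring_eval_monoid_morphism : monoid_morphism polyring_eval.
Proof.
split=> [|p q].
  (* By definition, the unit is the term with coefficient 1 at the trivial monomial. *)
  rewrite -[1]/(polyring_mon mone 1) polyring_evalU.
  by rewrite rmorph1 cmonom_eval1 mulr1.
rewrite -[p * q]/(polyring_mul p q) /polyring_mul.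
rewrite (raddf_sum polyring_eval) mulr_suml; apply: eq_bigr => m1 _.
rewrite (raddf_sum polyring_eval) mulr_sumr; apply: eq_bigr => m2 _.
by rewrite /= [LHS]polyring_evalU rmorphM cmonom_evalM mulrACA.
Qed.

HB.instance Definition _ :=
  GRing.isMonoidMorphism.Build (polyring A L) S polyring_eval
    polyring_eval_monoid_morphism.

(** An index may occur several times in [s]; its coefficients then add up. *)
Definition polyring_affine (a : A) (s : seq (A * L)) : polyring A L :=
  polyring_mon mone a + \sum_(t <- s) polyring_mon (ucm t.2) t.1.

Lemma polyring_eval_affine a s :
  polyring_eval (polyring_affine a s) = h a + \sum_(t <- s) h t.1 * v t.2.
Proof.
rewrite (raddfD polyring_eval) (raddf_sum polyring_eval) /=.
congr (_ + _).
  by rewrite [LHS]polyring_evalU cmonom_eval1 mulr1.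
by apply: eq_bigr => t _; rewrite [LHS]polyring_evalU cmonom_evalU.
Qed.

End PolyringEval.

Section AmalgMaps.
Variables (A B : comPzRingType) (f : {rmorphism A -> B}) (J : ideal B).

Fact amalg_diag_subproof a : (a, f a) \in amalg_set f J.
Proof.
by have [J0 _ _] := idealP J; apply/mem_set; exists a, 0; rewrite addr0.
Qed.

Definition amalg_diag a : amalg f J := Amalg (amalg_diag_subproof a).

Lemma amalg_diag_nmod_morphism : nmod_morphism amalg_diag.
Proof. by split=> [|a b]; apply: val_inj; rewrite /= ?(rmorph0, rmorphD). Qed.

HB.instance Definition _ :=
  GRing.isNmodMorphism.Build A (amalg f J) amalg_diag amalg_diag_nmod_morphism.

Lemma amalg_diag_monoid_morphism : monoid_morphism amalg_diag.
Proof. by split=> [|a b]; apply: val_inj; rewrite /= ?(rmorph1, rmorphM). Qed.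

HB.instance Definition _ :=
  GRing.isMonoidMorphism.Build A (amalg f J) amalg_diag
    amalg_diag_monoid_morphism.

Fact amalg_inr_subproof b : ideal_set J b -> (0, b) \in amalg_set f J.
Proof. by move=> Jb; apply/mem_set; exists 0, b; rewrite rmorph0 add0r. Qed.

(** This identifies [J] with the ideal [0 x J], the kernel of the first projection. *)
Definition amalg_inr b (Jb : ideal_set J b) : amalg f J := Amalg (amalg_inr_subproof Jb).

End AmalgMaps.

Lemma submod_gen_mem (A B : comPzRingType) (f : {rmorphism A -> B})
  (L : Type) (j : L -> B) l : submod_gen f j (j l).
Proof. by exists [:: (1, l)]; rewrite big_seq1 rmorph1 mul1r. Qed.

Theorem proposition4p1 (A B : comPzRingType) (f : {rmorphism A -> B})
    (J : ideal B) (Lambda : choiceType) (j : Lambda -> B)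
    (J_gen : (J : set B) = submod_gen f j) :
  exists phi : {rmorphism polyring A Lambda -> amalg f J},
    forall y : amalg f J, exists p : polyring A Lambda, phi p = y.
Proof.
(* Each generator lies in [J], so [(0, j l)] is a legitimate value for the indeterminate [X_l]. *)
have Jj l : ideal_set J (j l) by rewrite J_gen; apply: submod_gen_mem.
pose v l := amalg_inr f (Jj l).
exists (polyring_eval (amalg_diag f J) v) => y.
have /set_mem[a [b [Jb y_def]]] := amalgP y.
(* Conversely, every element of [J] is a finite combination of generators; its list [s] supplies the
   linear part of the preimage. *)
move: Jb; rewrite J_gen => -[s b_def].
exists (polyring_affine a s); rewrite [LHS]polyring_eval_affine.
apply: val_inj; rewrite (raddfD val) (raddf_sum val) /= y_def b_def.
(* Multiplying by [(a, f a)] acts on [0 x J] as the [A]-module structure of [J] via [f]. *)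
have -> : \sum_(t <- s) ((t.1, f t.1) : A * B) * (0, j t.2)
    = (0, \sum_(t <- s) f t.1 * j t.2).
  elim: s {b_def} => [|t s IHs]; first by rewrite !big_nil.
  rewrite !big_cons IHs.
  by congr pair; rewrite /= mulr0 addr0.
by congr pair; rewrite /= addr0.
Qed.
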